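(* Let $A,B$ be finite-dimensional systems and $\rho_{AB}\in\mathfrak{D}(AB)$ a bipartite state. Then the following are equivalent: 1. For every quantum conditional entropy $\mathbf{H}$, $\mathbf{H}(A|B)_\rho\ge 0$. 2. The reduction criterion holds: $I_A\otimes\rho_B\ge\rho_{AB}$ (Loewner order), where $\rho_B=\operatorname{Tr}_A[\rho_{AB}]$.
   Context: All systems (Hilbert spaces) are finite-dimensional; $|A|$ is the dimension of $A$, $\mathfrak{D}(A)$ the set of density operators on $A$, $I_A$ the identity, $\mathbf{u}_A=I_A/|A|$ the uniform state. A quantum channel is a completely positive trace-preserving linear map; an isometric channel is one of the form $(\cdot)\mapsto U(\cdot)U^\dagger$ with $U^\dagger U=I$. Maps act as the identity on systems not mentioned. Conditionally unital channel: $\mathcal{N}_{AB\to AB'}$ such that for every $\rho_B\in\mathfrak{D}(B)$ there is $\sigma_{B'}\in\mathfrak{D}(B')$ with $\mathcal{N}(\mathbf{u}_A\otimes\rho_B)=\mathbf{u}_A\otimes\sigma_{B'}$. $A\not\to B'$ semi-causal channel: $\mathcal{N}_{AB\to AB'}$ such that $\operatorname{Tr}_A\circ\mathcal{N}\circ\mathcal{M}_A=\operatorname{Tr}_A\circ\mathcal{N}$ for every channel $\mathcal{M}_A$ from $A$ to $A$. Conditionally mixing channel: a channel $\mathcal{N}_{AB\to AB'}$ that is both conditionally unital and $A\not\to B'$ semi-causal. Conditional majorization: $\rho_{AB}\succ_A\sigma_{A'B'}$ if there exist a system $A''$ with $|A''|\ge\max\{|A|,|A'|\}$, isometric channels $\mathcal{V}_{A\to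 A''}$, $\mathcal{U}_{A'\to A''}$, and a conditionally mixing channel $\mathcal{N}_{A''B\to A''B'}$ with $\mathcal{U}_{A'\to A''}(\sigma_{A'B'})=(\mathcal{N}_{A''B\to A''B'}\circ\mathcal{V}_{A\to A''})(\rho_{AB})$. Quantum conditional entropy: a function $\mathbf{H}:\bigcup_{A,B}\mathfrak{D}(AB)\to\mathbb{R}$ (value at $\rho_{AB}$ written $\mathbf{H}(A|B)_\rho$; one-dimensional systems allowed) that is not the zero function when $|B|=1$ and satisfies, for all systems and states: (1) monotonicity: $\rho_{AB}\succ_A\sigma_{A'B'}\Rightarrow\mathbf{H}(A|B)_\rho\le\mathbf{H}(A'|B')_\sigma$; (2) additivity: $\mathbf{H}(AA'|BB')_{\rho\otimes\sigma}=\mathbf{H}(A|B)_\rho+\mathbf{H}(A'|B')_\sigma$. *)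

(* Defs.v *)
From HB Require Import structures.
From mathcomp Require Import all_boot all_order all_algebra.
From mathcomp Require Import complex mxtens reals.

Set Implicit Arguments.
Unset Strict Implicit.
Unset Printing Implicit Defensive.
Import Order.TTheory GRing.Theory Num.Theory.
Local Open Scope ring_scope.
Local Open Scope sesquilinear_scope.

(* A system of dimension [a] is the Hilbert space C^a with C = R[i], and its   *)
(* operators are the matrices 'M[R[i]]_a.  The composite system of A and B,    *)
(* of dimensions [a] and [b], is C^(a * b), with the index pairing             *)
(* [mxtens_index : 'I_a * 'I_b -> 'I_(a * b)] underlying [*t].                 *)
(* Dimensions are not assumed positive: a density operator has trace 1, so     *)
(* any system that carries a state has positive dimension.                     *)

Section Operators.
Variable R : realType.
Local Notation C := R[i].

(* Over the partially ordered field R[i], [0 <= z] includes that z is real.    *)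
Definition psdmx n (X : 'M[C]_n) : Prop :=
  forall v : 'cV[C]_n, 0 <= (v ^t* *m X *m v) 0 0.

Definition loewner_le n (X Y : 'M[C]_n) : Prop := psdmx (Y - X).

Definition density n (rho : 'M[C]_n) : Prop := psdmx rho /\ \tr rho = 1.

Definition uniform_state a : 'M[C]_a := (a%:R^-1)%:M.

Definition ptrace1 a b (X : 'M[C]_(a * b)) : 'M[C]_b :=
  \matrix_(k, l) \sum_(i < a) X (mxtens_index (i, k)) (mxtens_index (i, l)).

(* For linear f and g, this is their tensor product: X is expanded in the      *)
(* basis |i><j| (x) |k><l| of matrix units.                                    *)
Definition tensor_map a a' b b' (f : 'M[C]_a -> 'M[C]_a')
    (g : 'M[C]_b -> 'M[C]_b') (X : 'M[C]_(a * b)) : 'M[C]_(a' * b') :=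
  \sum_(i < a) \sum_(j < a) \sum_(k < b) \sum_(l < b)
    X (mxtens_index (i, k)) (mxtens_index (j, l))
      *: (f (delta_mx i j) *t g (delta_mx k l)).

Definition completely_positive m n (f : 'M[C]_m -> 'M[C]_n) : Prop :=
  forall k (X : 'M[C]_(k * m)), psdmx X -> psdmx (tensor_map (@id 'M_k) f X).

Definition channel m n (f : {linear 'M[C]_m -> 'M[C]_n}) : Prop :=
  completely_positive f /\ (forall X, \tr (f X) = \tr X).

Definition isometric_channel m n (f : {linear 'M[C]_m -> 'M[C]_n}) : Prop :=
  exists U : 'M[C]_(n, m),
    U ^t* *m U = 1%:M /\ (forall X, f X = U *m X *m U ^t*).

Definition conditionally_unital a b b'
    (N : {linear 'M[C]_(a * b) -> 'M[C]_(a * b')}) : Prop :=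
  forall rho : 'M[C]_b, density rho ->
    exists sigma : 'M[C]_b', density sigma /\
      N (uniform_state a *t rho) = uniform_state a *t sigma.

Definition semi_causal a b b'
    (N : {linear 'M[C]_(a * b) -> 'M[C]_(a * b')}) : Prop :=
  forall M : {linear 'M[C]_a -> 'M[C]_a}, channel M ->
    forall X : 'M[C]_(a * b),
      ptrace1 (N (tensor_map M (@id 'M_b) X)) = ptrace1 (N X).

Definition conditionally_mixing a b b'
    (N : {linear 'M[C]_(a * b) -> 'M[C]_(a * b')}) : Prop :=
  [/\ channel N, conditionally_unital N & semi_causal N].

Definition cond_majorizes a b a' b'
    (rho : 'M[C]_(a * b)) (sigma : 'M[C]_(a' * b')) : Prop :=
  exists (c : nat)
    (V : {linear 'M[C]_a -> 'M[C]_c}) (U : {linear 'M[C]_a' -> 'M[C]_c})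
    (N : {linear 'M[C]_(c * b) -> 'M[C]_(c * b')}),
    [/\ (maxn a a' <= c)%N, isometric_channel V, isometric_channel U,
        conditionally_mixing N &
        tensor_map U (@id 'M_b') sigma = N (tensor_map V (@id 'M_b) rho)].

Definition swap_middle a b a' b'
    (x : 'I_((a * a') * (b * b'))) : 'I_((a * b) * (a' * b')) :=
  let: (p, q) := mxtens_unindex x in
  let: (i, i') := mxtens_unindex p in
  let: (k, k') := mxtens_unindex q in
  mxtens_index (mxtens_index (i, k), mxtens_index (i', k')).

(* The product of states on AB and A'B', seen as a bipartite state of AA' and  *)
(* BB': the factors of A (x) B (x) A' (x) B' are put in the order A A' B B'.   *)
Definition bipartite_tensor a b a' b'
    (rho : 'M[C]_(a * b)) (sigma : 'M[C]_(a' * b')) :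
    'M[C]_((a * a') * (b * b')) :=
  mxsub (@swap_middle a b a' b') (@swap_middle a b a' b') (rho *t sigma).

(* [H a b rho] is H(A|B)_rho; only its values on density operators matter.     *)
Record quantum_cond_entropy (H : forall a b : nat, 'M[C]_(a * b) -> R) :
    Prop := QuantumCondEntropy {
  qce_nontrivial : exists (a : nat) (rho : 'M[C]_(a * 1)),
    density rho /\ H a 1 rho <> 0;
  qce_monotone : forall (a b a' b' : nat)
      (rho : 'M[C]_(a * b)) (sigma : 'M[C]_(a' * b')),
    density rho -> density sigma -> cond_majorizes rho sigma ->
    H a b rho <= H a' b' sigma;
  qce_additive : forall (a b a' b' : nat)
      (rho : 'M[C]_(a * b)) (sigma : 'M[C]_(a' * b')),
    density rho -> density sigma ->
    H (a * a')%N (b * b')%N (bipartite_tensor rho sigma)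
      = H a b rho + H a' b' sigma
}.

End Operators.

(* Main.v *)
(* If the reduction criterion holds, then the one-dimensional state 1, whose
   entropy is 0 by additivity, majorizes rho: with P a rank-one projection on a
   system of dimension |A|, the channel
     X |-> tr (P X) rho + tr ((1 - P) X) (1 (x) rho_B - rho) / (|A| - 1)
   is conditionally mixing and sends P to rho.
   Conversely, - ln inf {l | rho <= l (1 (x) rho_B)} is a conditional entropy,
   nonnegative exactly under the reduction criterion.  Monotonicity: applying
   semi-causality to the depolarizing channel shows that a conditionally mixing
   channel N maps 1 (x) X_B to 1 (x) N(X)_B, so it preserves rho <= l (1 (x) rho_B).
   Additivity: testing the order on product vectors shows that the optimal
   constants multiply. *)
From HB Require Import structures.
Require Import Defs.
From mathcomp Require Import all_boot all_order all_algebra.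
From mathcomp Require Import complex mxtens reals ring.
From mathcomp Require Import classical_sets exp.
Set Implicit Arguments.
Unset Strict Implicit.
Unset Printing Implicit Defensive.
Import Order.TTheory GRing.Theory Num.Theory.
Local Open Scope ring_scope.
Local Open Scope sesquilinear_scope.

(** * Positive semidefinite matrices *)

(* [psd], [tmap], [cp] and [ptr] below are [psdmx], [tensor_map],
   [completely_positive] and [ptrace1] over an arbitrary numClosedFieldType, and
   their instances at R[i] are convertible to the latter.  Over the concrete
   field R[i], unification unfolds the complex numbers and becomes intractable. *)
Section PositiveSemidefinite.
Variable C : numClosedFieldType.

Definition psd n (X : 'M[C]_n) : Prop :=
  forall v : 'cV[C]_n, 0 <= (v ^t* *m X *m v) 0 0.

Lemma adjmxM m n p (A : 'M[C]_(m, n)) (B : 'M[C]_(n, p)) :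
  (A *m B)^t* = B^t* *m A^t*.
Proof. by rewrite trmx_mul map_mxM. Qed.

Lemma adjmx1 n : (1%:M : 'M[C]_n)^t* = 1%:M.
Proof. by rewrite trmx1 map_mx1. Qed.

Lemma adjmx_tens m n p q (A : 'M[C]_(m, n)) (B : 'M[C]_(p, q)) :
  (A *t B)^t* = A^t* *t B^t*.
Proof. by rewrite trmx_tens map_mxT. Qed.

Lemma adjmx_delta m n (i : 'I_m) (j : 'I_n) :
  (delta_mx i j : 'M[C]__)^t* = delta_mx j i.
Proof. by rewrite trmx_delta map_delta_mx. Qed.

Lemma psd0 n : psd (0 : 'M[C]_n).
Proof. by move=> v; rewrite mulmx0 mul0mx mxE. Qed.

Lemma psdD n (X Y : 'M[C]_n) : psd X -> psd Y -> psd (X + Y).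
Proof.
by move=> pX pY v; rewrite mulmxDr mulmxDl mxE addr_ge0 ?pX ?pY.
Qed.

Lemma psd_sum (I : Type) (r : seq I) (P : pred I) n (F : I -> 'M[C]_n) :
  (forall i, P i -> psd (F i)) -> psd (\sum_(i <- r | P i) F i).
Proof.
move=> pF; apply: (big_ind (@psd n)) => //; first exact: psd0.
exact: psdD.
Qed.

Lemma psdZ n (c : C) (X : 'M[C]_n) : 0 <= c -> psd X -> psd (c *: X).
Proof.
by move=> c0 pX v; rewrite -scalemxAr -scalemxAl mxE mulr_ge0 ?pX.
Qed.

Lemma psd_conj m n (K : 'M[C]_(n, m)) (X : 'M[C]_m) :
  psd X -> psd (K *m X *m K^t*).
Proof.
move=> pX v; have := pX (K^t* *m v).
by rewrite adjmxM trmxCK !mulmxA.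
Qed.

Lemma psd1 n : psd (1%:M : 'M[C]_n).
Proof.
move=> v; rewrite mulmx1 mxE sumr_ge0 // => i _.
by rewrite !mxE mulrC mul_conjC_ge0.
Qed.

Lemma psd_gram m n (K : 'M[C]_(n, m)) : psd (K *m K^t*).
Proof. by rewrite -[K in K *m _]mulmx1; apply/psd_conj/psd1. Qed.

Lemma sesqui_delta n (Y : 'M[C]_n) i j :
  ((delta_mx i 0 : 'cV[C]_n)^t* *m Y *m (delta_mx j 0 : 'cV[C]_n)) 0 0 = Y i j.
Proof. by rewrite adjmx_delta -rowE -colE !mxE. Qed.

(* Polarization. *)
Lemma psd_herm n (X : 'M[C]_n) : psd X -> X^t* = X.
Proof.
move=> pX; pose Y := X - X^t*.
have qY0 (v : 'cV[C]_n) : (v^t* *m Y *m v) 0 0 = 0.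
  rewrite mulmxBr mulmxBl !mxE; apply/eqP; rewrite subr_eq0; apply/eqP.
  have -> : \sum_j (v^t* *m X^t*) 0 j * v j 0 = ((v^t* *m X *m v)^t*) 0 0.
    by rewrite !adjmxM trmxCK mulmxA mxE.
  by rewrite [in RHS]mxE [in RHS]mxE geC0_conj ?pX // mxE.
have YE (c : C) i j : c * Y i j + c^* * Y j i = 0.
  pose u : 'cV[C]_n := delta_mx i 0; pose w : 'cV[C]_n := delta_mx j 0.
  have adjuw : (u + c *: w)^t* = u^t* + c^* *: w^t*.
    by apply/matrixP=> k l; rewrite !mxE rmorphD rmorphM.
  have expand : (u + c *: w)^t* *m Y *m (u + c *: w) =
      u^t* *m Y *m u + c *: (u^t* *m Y *m w) +
      (c^* *: (w^t* *m Y *m u) + (c^* * c) *: (w^t* *m Y *m w)).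
    rewrite adjuw mulmxDl -scalemxAl mulmxDl !mulmxDr -!scalemxAl -!scalemxAr.
    by rewrite scalerA.
  have := qY0 (u + c *: w); rewrite expand => /eqP.
  have mxD (A B : 'M[C]_1) : (A + B) 0 0 = A 0 0 + B 0 0 by rewrite mxE.
  have mxZ d (A : 'M[C]_1) : (d *: A) 0 0 = d * A 0 0 by rewrite mxE.
  rewrite !mxD !mxZ !qY0 !sesqui_delta mulr0 add0r addr0.
  by move/eqP.
have Y0 : Y = 0.
  apply/matrixP=> i j; rewrite [RHS]mxE.
  have h1 := YE 1 i j; have h2 := YE 'i%R i j.
  move: h1 h2; rewrite rmorph1 !mul1r conjCi mulNr -mulrBr => h1 /eqP.
  rewrite mulf_eq0 (negPf (neq0Ci _)) /= subr_eq0 => /eqP h2.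
  move: h1; rewrite -h2 -mulr2n => /eqP.
  by rewrite mulrn_eq0 /= => /eqP.
by apply/esym/eqP; rewrite -subr_eq0 -/Y Y0.
Qed.

(** By the spectral theorem [X] is [P^t* *m diag_mx d *m P] with [P] unitary and [d] nonnegative;
    [P^t*] times the diagonal of square roots is a factor. *)
Lemma psd_factor n (X : 'M[C]_n) : psd X -> exists B : 'M[C]_n, X = B *m B^t*.
Proof.
move=> pX.
have nX : X \is normalmx by apply/normalmxP; rewrite psd_herm.
set P := spectralmx X; set d := spectral_diag X.
have uP : P \is unitarymx by apply: spectral_unitarymx.
have XE : X = P^t* *m diag_mx d *m P.
  by rewrite -invmx_unitary //; apply/orthomx_spectralP.
have dE : diag_mx d = P *m X *m P^t*.
  rewrite XE !mulmxA (unitarymxP uP) mul1mx -mulmxA (unitarymxP uP).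
  by rewrite mulmx1.
have d0 i : 0 <= d 0 i.
  have := psd_conj P pX (delta_mx i 0).
  by rewrite -dE sesqui_delta mxE eqxx mulr1n.
pose s : 'rV[C]_n := map_mx sqrtC d.
exists (P^t* *m diag_mx s); rewrite adjmxM trmxCK XE !mulmxA; congr (_ *m _).
rewrite -mulmxA; congr (_ *m _).
have -> : (diag_mx s)^t* = diag_mx s.
  apply/matrixP=> i j; rewrite !mxE; have [->|ij] := eqVneq j i.
    by rewrite !mulr1n geC0_conj // sqrtC_ge0.
  by rewrite !mulr0n rmorph0.
rewrite mulmx_diag; congr diag_mx; apply/rowP => i.
by rewrite !mxE -expr2 sqrtCK.
Qed.

Lemma psd_tens m n (X : 'M[C]_m) (Y : 'M[C]_n) :
  psd X -> psd Y -> psd (X *t Y).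
Proof.
move=> /psd_factor[A ->] /psd_factor[B ->].
by rewrite -tensmx_mul -adjmx_tens; apply: psd_gram.
Qed.

(** A principal submatrix, repetitions allowed, is the compression by those rows of the identity
    that [f] selects. *)
Lemma psd_mxsub m n (f : 'I_m -> 'I_n) (X : 'M[C]_n) :
  psd X -> psd (mxsub f f X).
Proof.
move=> pX; have -> : mxsub f f X = rowsub f 1%:M *m X *m (rowsub f 1%:M)^t*.
  rewrite trmx_mxsub map_mxsub adjmx1 mul_rowsub_mx mul1mx.
  by rewrite mulmx_colsub mulmx1 -mxsub_comp.
exact: psd_conj.
Qed.

(** Serves to test the Loewner order on product vectors. As [1 * 1] computes to 1, [w] can be typed
    as a column without a cast. *)
Lemma sesqui_tens m n (X : 'M[C]_m) (Y : 'M[C]_n) (u : 'cV[C]_m)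
    (v : 'cV[C]_n) (w := u *t v : 'cV[C]_(m * n)) :
  (w^t* *m (X *t Y) *m w) 0 0 = (u^t* *m X *m u) 0 0 * (v^t* *m Y *m v) 0 0.
Proof.
have adjw : w^t* = (u^t* *t v^t* : 'M[C]_(1 * 1, m * n)) := adjmx_tens u v.
have -> : w^t* *m (X *t Y) *m w = (u^t* *m X *m u) *t (v^t* *m Y *m v).
  have -> : w^t* *m (X *t Y) = (u^t* *m X) *t (v^t* *m Y) :> 'rV_(m * n).
    by rewrite adjw; exact: (@tensmx_mul _ 1 m 1 n m n).
  exact: (@tensmx_mul _ 1 m 1 n 1 1).
by rewrite mxE; congr (_ * _); congr (fun_of_matrix _ _ _); apply: ord1.
Qed.

End PositiveSemidefinite.

(** * Tensor products, partial trace and complete positivity *)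

Section Tensor.
Variable C : numClosedFieldType.

(** Maps mostly appear as bare functions with a proof of [linear]; the bundled structure is built
    only inside the proof. *)
Lemma linear_sumP (U V : lmodType C) (f : U -> V) : linear f ->
  forall (I : Type) (r : seq I) (P : pred I) (F : I -> U),
    f (\sum_(i <- r | P i) F i) = \sum_(i <- r | P i) f (F i).
Proof.
move=> lf I r P F.
pose L : {linear U -> V} := HB.pack f (GRing.isLinear.Build C U V *:%R f lf).
exact: (linear_sum L).
Qed.

Lemma linear_scaleP (U V : lmodType C) (f : U -> V) : linear f ->
  forall c u, f (c *: u) = c *: f u.
Proof.
move=> lf c u.
pose L : {linear U -> V} := HB.pack f (GRing.isLinear.Build C U V *:%R f lf).
exact: (linearZZ L).
Qed.

Lemma sum_mxtens (V : nmodType) m n (F : 'I_(m * n) -> V) :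
  \sum_p F p = \sum_i \sum_j F (mxtens_index (i, j)).
Proof.
rewrite pair_big /= (reindex (@mxtens_index m n)) /=; last first.
  by exists (@mxtens_unindex m n) => p _; rewrite ?mxtens_indexK ?mxtens_unindexK.
by apply: eq_bigr => -[].
Qed.

Lemma mxtens_matrixP m n p q (A B : 'M[C]_(m * n, p * q)) :
  (forall i j k l, A (mxtens_index (i, k)) (mxtens_index (j, l))
                 = B (mxtens_index (i, k)) (mxtens_index (j, l))) -> A = B.
Proof.
move=> AB; apply/matrixP => x y.
by case: (mxtens_indexP x) => i k; case: (mxtens_indexP y) => j l.
Qed.

Lemma tensmx_linearl m n p q (B : 'M[C]_(p, q)) :
  linear (fun A : 'M[C]_(m, n) => A *t B).
Proof.
by move=> c X Y; apply/matrixP => x y; rewrite !mxE mulrDl mulrA.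
Qed.

Lemma tensmx_linearr m n p q (A : 'M[C]_(m, n)) :
  linear (fun B : 'M[C]_(p, q) => A *t B).
Proof.
by move=> c X Y; apply/matrixP => x y; rewrite !mxE mulrDr mulrCA.
Qed.

Lemma sandwich_linear m n p q (A : 'M[C]_(m, n)) (B : 'M[C]_(p, q)) :
  linear (fun X => A *m X *m B).
Proof. by move=> c X Y; rewrite mulmxDr mulmxDl -scalemxAr -scalemxAl. Qed.

Lemma delta_mx_tens m n p q (i : 'I_m) (j : 'I_n) (k : 'I_p) (l : 'I_q) :
  delta_mx (mxtens_index (i, k)) (mxtens_index (j, l))
  = delta_mx i j *t delta_mx k l :> 'M[C]_(m * p, n * q).
Proof.
apply: mxtens_matrixP => *; rewrite tensmxE !mxE -natrM mulnb.
by rewrite !(can_eq (@mxtens_indexK _ _)) !xpair_eqE andbACA.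
Qed.

Lemma mxtens_expand m n p q (X : 'M[C]_(m * p, n * q)) :
  X = \sum_i \sum_j \sum_k \sum_l X (mxtens_index (i, k)) (mxtens_index (j, l))
        *: (delta_mx i j *t delta_mx k l).
Proof.
rewrite [LHS]matrix_sum_delta sum_mxtens; apply: eq_bigr => i _.
rewrite exchange_big sum_mxtens /=; apply: eq_bigr => j _.
rewrite exchange_big; apply: eq_bigr => k _; apply: eq_bigr => l _.
by rewrite delta_mx_tens.
Qed.

Lemma linear_mxtens m n p q (V : lmodType C) (f : 'M[C]_(m * p, n * q) -> V) X :
  linear f ->
  f X = \sum_i \sum_j \sum_k \sum_l X (mxtens_index (i, k)) (mxtens_index (j, l))
          *: f (delta_mx i j *t delta_mx k l).
Proof.
move=> lf; rewrite [X in LHS]mxtens_expand.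
do 4![rewrite (linear_sumP lf); apply: eq_bigr => ? _].
exact: linear_scaleP.
Qed.

Lemma linear_delta m n (V : lmodType C) (f : 'M[C]_(m, n) -> V) X :
  linear f -> f X = \sum_i \sum_j X i j *: f (delta_mx i j).
Proof.
move=> lf; rewrite [X in LHS]matrix_sum_delta.
do 2![rewrite (linear_sumP lf); apply: eq_bigr => ? _].
exact: linear_scaleP.
Qed.

(** Matrix units of a tensor product are products of matrix units, so a linear map is determined by
    its values on products. *)
Lemma mxtens_ext m n p q (V : lmodType C) (f g : 'M[C]_(m * p, n * q) -> V) :
    linear f -> linear g -> (forall A B, f (A *t B) = g (A *t B)) -> f =1 g.
Proof.
move=> lf lg fg X; rewrite (linear_mxtens X lf) (linear_mxtens X lg).
by do 4![apply: eq_bigr => ? _]; rewrite fg.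
Qed.

Definition tmap a a' b b' (f : 'M[C]_a -> 'M[C]_a')
    (g : 'M[C]_b -> 'M[C]_b') (X : 'M[C]_(a * b)) : 'M[C]_(a' * b') :=
  \sum_(i < a) \sum_(j < a) \sum_(k < b) \sum_(l < b)
    X (mxtens_index (i, k)) (mxtens_index (j, l))
      *: (f (delta_mx i j) *t g (delta_mx k l)).

Lemma tmapE a a' b b' (f : 'M[C]_a -> 'M[C]_a') (g : 'M[C]_b -> 'M[C]_b')
    (h : 'M[C]_(a * b) -> 'M[C]_(a' * b')) : linear h ->
  (forall A B, h (A *t B) = f A *t g B) -> tmap f g =1 h.
Proof.
move=> lh hE X; rewrite (linear_mxtens X lh).
by do 4![apply: eq_bigr => ? _]; rewrite hE.
Qed.

Lemma tmap_tens a a' b b' (f : 'M[C]_a -> 'M[C]_a') (g : 'M[C]_b -> 'M[C]_b') A B :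
  linear f -> linear g -> tmap f g (A *t B) = f A *t g B.
Proof.
move=> lf lg.
rewrite (linear_delta A lf) (linear_sumP (@tensmx_linearl _ _ _ _ _)).
apply: eq_bigr => i _; rewrite (linear_sumP (@tensmx_linearl _ _ _ _ _)).
apply: eq_bigr => j _; rewrite (linear_scaleP (@tensmx_linearl _ _ _ _ _)).
rewrite (linear_delta B lg) (linear_sumP (@tensmx_linearr _ _ _ _ _)) scaler_sumr.
apply: eq_bigr => k _; rewrite (linear_sumP (@tensmx_linearr _ _ _ _ _)) scaler_sumr.
apply: eq_bigr => l _; rewrite (linear_scaleP (@tensmx_linearr _ _ _ _ _)).
by rewrite scalerA tensmxE.
Qed.

Lemma tmap_conj a a' b b' (K : 'M[C]_(a', a)) (L : 'M[C]_(b', b)) :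
  tmap (fun X => K *m X *m K^t*) (fun X => L *m X *m L^t*)
  =1 fun X => (K *t L) *m X *m (K *t L)^t*.
Proof.
apply: tmapE => [|A B]; first exact: sandwich_linear.
by rewrite adjmx_tens !tensmx_mul.
Qed.

Lemma eq_tmap a a' b b' (f f' : 'M[C]_a -> 'M[C]_a') (g g' : 'M[C]_b -> 'M[C]_b') :
  f =1 f' -> g =1 g' -> tmap f g =1 tmap f' g'.
Proof.
move=> ff gg X; apply: eq_bigr => i _; apply: eq_bigr => j _.
by apply: eq_bigr => k _; apply: eq_bigr => l _; rewrite ff gg.
Qed.

(** Brings tensor products with an identity factor under [tmap_conj]. *)
Lemma id_conj a : @id 'M[C]_a =1 fun X => 1%:M *m X *m (1%:M : 'M[C]_a)^t*.
Proof. by move=> X; rewrite adjmx1 mul1mx mulmx1. Qed.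

(** * Complete positivity from Kraus operators *)

Definition cp m n (f : 'M[C]_m -> 'M[C]_n) : Prop :=
  forall k (X : 'M[C]_(k * m)), psd X -> psd (tmap (@id 'M_k) f X).

Lemma eq_cp m n (f g : 'M[C]_m -> 'M[C]_n) : f =1 g -> cp f -> cp g.
Proof. by move=> fg cf k X pX; rewrite -(eq_tmap (frefl _) fg); apply: cf. Qed.

Lemma cp_conj m n (K : 'M[C]_(n, m)) : cp (fun X => K *m X *m K^t*).
Proof.
move=> k X pX; rewrite (eq_tmap (@id_conj _) (frefl _)) tmap_conj.
exact: psd_conj.
Qed.

Lemma cp_sum (I : finType) m n (f : I -> 'M[C]_m -> 'M[C]_n) :
  (forall i, cp (f i)) -> cp (fun X => \sum_i f i X).
Proof.
move=> cf k X pX; have -> : tmap id (fun X => \sum_i f i X) X = \sum_i tmap id (f i) X.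
  rewrite /tmap; do 4![rewrite [RHS]exchange_big; apply: eq_bigr => ? _ /=].
  rewrite -scaler_sumr; congr (_ *: _).
  exact: (linear_sumP (@tensmx_linearr _ _ _ _ _)).
by apply: psd_sum => i _; apply: cf.
Qed.

Lemma delta_mx_sandwich m n p q (i : 'I_m) j k (l : 'I_q) (Z : 'M[C]_(n, p)) :
  delta_mx i j *m Z *m delta_mx k l = Z j k *: delta_mx i l.
Proof.
rewrite -(mul_delta_mx (0 : 'I_1) i j) -(mul_delta_mx (0 : 'I_1) k l).
transitivity (delta_mx i (0 : 'I_1) *m (delta_mx (0 : 'I_1) j *m Z
              *m delta_mx k (0 : 'I_1)) *m delta_mx (0 : 'I_1) l).
  by rewrite !mulmxA.
have -> : delta_mx 0 j *m Z *m delta_mx k 0 = (Z j k)%:M :> 'M_1.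
  by rewrite [LHS]mx11_scalar -rowE -colE !mxE.
by rewrite mul_mx_scalar -scalemxAl mul_delta_mx.
Qed.

(** With [E = G *m G^t*] and [rho = L *m L^t*], the operators [L *m delta_mx q p *m G^t*] are Kraus
    operators: summing over [p] produces the trace, summing over [q] the state. *)
Lemma cp_measure_prepare m n (E : 'M[C]_m) (rho : 'M[C]_n) :
  psd E -> psd rho -> cp (fun X => \tr (E *m X) *: rho).
Proof.
move=> /psd_factor[G ->] /psd_factor[L ->].
pose K p q := L *m delta_mx q p *m G^t*.
apply: (@eq_cp _ _ (fun X => \sum_p \sum_q K p q *m X *m (K p q)^t*)); last first.
  by apply: cp_sum => p; apply: cp_sum => q; apply: cp_conj.
move=> X; rewrite -mulmxA mxtrace_mulC; set Z := G^t* *m X *m G.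
have -> : \tr (G^t* *m X *m G) *: (L *m L^t*) = L *m (\tr Z)%:M *m L^t*.
  by rewrite mul_mx_scalar -scalemxAl.
have -> : (\tr Z)%:M = \sum_p \sum_q delta_mx q p *m Z *m delta_mx p q :> 'M_n.
  transitivity (\sum_p \sum_q Z p p *: (delta_mx q q : 'M[C]_n)).
    rewrite scalar_mx_sum_delta exchange_big; apply: eq_bigr => q _ /=.
    by rewrite -scaler_suml.
  by apply: eq_bigr => p _; apply: eq_bigr => q _; rewrite delta_mx_sandwich.
rewrite mulmx_sumr mulmx_suml; apply: eq_bigr => p _.
rewrite mulmx_sumr mulmx_suml; apply: eq_bigr => q _.
by rewrite /K /Z !adjmxM adjmx_delta trmxCK !mulmxA.
Qed.

(** * Partial trace and exchange of tensor factors *)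

Definition ptr a b (X : 'M[C]_(a * b)) : 'M[C]_b :=
  \matrix_(k, l) \sum_(i < a) X (mxtens_index (i, k)) (mxtens_index (i, l)).

Lemma ptr_linear a b : linear (@ptr a b).
Proof.
move=> c X Y; apply/matrixP => k l; rewrite !mxE mulr_sumr -big_split /=.
by apply: eq_bigr => i _; rewrite !mxE.
Qed.

Lemma ptr_tens a b (A : 'M[C]_a) (B : 'M[C]_b) : ptr (A *t B) = \tr A *: B.
Proof.
apply/matrixP => k l; rewrite !mxE mulr_suml; apply: eq_bigr => i _.
by rewrite tensmxE.
Qed.

Lemma mxtrace_ptr a b (X : 'M[C]_(a * b)) : \tr (ptr X) = \tr X.
Proof.
rewrite /mxtrace sum_mxtens exchange_big; apply: eq_bigr => k _.
by rewrite mxE.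
Qed.

(** The partial trace is the sum of the diagonal blocks, which are principal submatrices. *)
Lemma psd_ptr a b (X : 'M[C]_(a * b)) : psd X -> psd (ptr X).
Proof.
move=> pX; have -> : ptr X = \sum_i mxsub (fun k => mxtens_index (i, k))
                                        (fun k => mxtens_index (i, k)) X.
  by apply/matrixP => k l; rewrite mxE summxE; apply: eq_bigr => i _; rewrite mxE.
by apply: psd_sum => i _; apply: psd_mxsub.
Qed.

Lemma ptr_isometry a a' b (U : 'M[C]_(a', a)) (X : 'M[C]_(a * b)) :
  U^t* *m U = 1%:M -> ptr ((U *t 1%:M) *m X *m (U *t 1%:M)^t*) = ptr X.
Proof.
move=> UU; apply: (mxtens_ext (f := fun X => ptr (_ *m X *m _))) X => [c X Y||A B].
- by rewrite sandwich_linear ptr_linear.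
- exact: ptr_linear.
rewrite adjmx_tens !tensmx_mul adjmx1 mul1mx mulmx1 !ptr_tens.
by rewrite -mulmxA mxtrace_mulC -mulmxA UU mulmx1.
Qed.

Lemma tmap_prepare a a' b (u : 'M[C]_a') :
  tmap (fun X : 'M[C]_a => \tr X *: u) (@id 'M[C]_b) =1 fun X => u *t ptr X.
Proof.
apply: tmapE => [c X Y|A B]; first by rewrite ptr_linear tensmx_linearr.
by rewrite ptr_tens; apply/matrixP => x y; rewrite !mxE mulrCA mulrA.
Qed.

(** The permutation in [bipartite_tensor], split off as a linear map so that it also applies to
    differences of products. *)
Definition reorder a b a' b' :
    'M[C]_((a * b) * (a' * b')) -> 'M[C]_((a * a') * (b * b')) :=
  mxsub (@swap_middle a b a' b') (@swap_middle a b a' b').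

Lemma swap_middleE a b a' b' (i : 'I_a) (k : 'I_b) (i' : 'I_a') (k' : 'I_b') :
  swap_middle (mxtens_index (mxtens_index (i, i'), mxtens_index (k, k')))
  = mxtens_index (mxtens_index (i, k), mxtens_index (i', k')).
Proof. by rewrite /swap_middle !mxtens_indexK. Qed.

Lemma reorder_tens a b a' b' (A : 'M[C]_a) (B : 'M[C]_b) (A' : 'M[C]_a') (B' : 'M[C]_b') :
  reorder ((A *t B) *t (A' *t B')) = (A *t A') *t (B *t B').
Proof.
apply/matrixP => x y; rewrite mxE.
case: (mxtens_indexP x) => p q; case: (mxtens_indexP p) => i i'.
case: (mxtens_indexP q) => k k'.
case: (mxtens_indexP y) => r s; case: (mxtens_indexP r) => j j'.
case: (mxtens_indexP s) => l l'.
by rewrite !swap_middleE !tensmxE mulrACA.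
Qed.

Lemma ptr_reorder a b a' b' (X : 'M[C]_(a * b)) (Y : 'M[C]_(a' * b')) :
  ptr (reorder (X *t Y)) = ptr X *t ptr Y.
Proof.
apply: mxtens_matrixP => k l k' l'; rewrite mxE tensmxE !mxE sum_mxtens mulr_suml.
apply: eq_bigr => i _; rewrite mulr_sumr; apply: eq_bigr => i' _.
by rewrite mxE !swap_middleE tensmxE.
Qed.

(** The inverse permutation is again a [swap_middle], with the two middle dimensions exchanged, so
    each direction takes a principal submatrix. *)
Lemma psd_reorder a b a' b' (X : 'M[C]_((a * b) * (a' * b'))) :
  psd (reorder X) <-> psd X.
Proof.
split; last exact: psd_mxsub.
move=> /(psd_mxsub (@swap_middle a a' b b')).
rewrite -mxsub_comp; congr psd; rewrite -[RHS]mxsub_id; apply: eq_mxsub => x /=.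
all: case: (mxtens_indexP x) => p q; case: (mxtens_indexP p) => i i'.
all: by case: (mxtens_indexP q) => k k'; rewrite !swap_middleE.
Qed.

Lemma tensmx11 m n : (1%:M : 'M[C]_m) *t (1%:M : 'M[C]_n) = 1%:M.
Proof.
apply: mxtens_matrixP => i j k l; rewrite tensmxE !mxE -natrM mulnb.
by rewrite (can_eq (@mxtens_indexK _ _)) xpair_eqE.
Qed.

Lemma reorder11 a b a' b' :
  reorder ((1%:M : 'M[C]_(a * b)) *t (1%:M : 'M[C]_(a' * b'))) = 1%:M.
Proof. by rewrite -(tensmx11 a) -(tensmx11 a') reorder_tens !tensmx11. Qed.

(** A Kraus decomposition of the unnormalized depolarizing map on A; its terms with [i = j] form the
    pinching. *)
Lemma tens1_ptr a b (X : 'M[C]_(a * b)) :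
  1%:M *t ptr X = \sum_(i < a) \sum_(j < a)
    (delta_mx i j *t 1%:M) *m X *m (delta_mx i j *t 1%:M)^t*.
Proof.
move: X; apply: (mxtens_ext (f := fun X => _ *t ptr X)) => [c X Y|c X Y|A B].
- by rewrite ptr_linear tensmx_linearr.
- rewrite scaler_sumr -big_split; apply: eq_bigr => i _ /=.
  rewrite scaler_sumr -big_split; apply: eq_bigr => j _ /=.
  exact: sandwich_linear.
rewrite ptr_tens exchange_big /= /mxtrace scaler_suml.
rewrite (linear_sumP (@tensmx_linearr _ _ _ _ _)); apply: eq_bigr => j _.
rewrite scalar_mx_sum_delta (linear_sumP (@tensmx_linearl _ _ _ _ _)).
apply: eq_bigr => i _; rewrite adjmx_tens adjmx_delta !tensmx_mul adjmx1 mul1mx mulmx1.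
rewrite delta_mx_sandwich scale1r.
by apply/matrixP => x y; rewrite !mxE mulrCA mulrA.
Qed.

(* The pinching inequality: with the orthogonal projections P i summing to 1,
   the sum of the (P i - P j) X (P i - P j) is 2 (a * \sum_i P i X P i - X). *)
Lemma psd_pinching a b (X : 'M[C]_(a * b)) :
  psd X -> psd (a%:R *: (1%:M *t ptr X) - X).
Proof.
move=> pX; pose E i j : 'M[C]_(a * b) := delta_mx (i : 'I_a) j *t 1%:M.
pose S : 'M[C]_(a * b) := \sum_i E i i *m X *m E i i.
have adjE i : (E i i)^t* = E i i by rewrite adjmx_tens adjmx_delta adjmx1.
have sumE : \sum_i E i i = 1%:M.
  rewrite -(linear_sumP (@tensmx_linearl _ _ _ _ _)).
  have -> : \sum_i delta_mx i i = 1%:M :> 'M[C]_a.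
    by rewrite scalar_mx_sum_delta; apply: eq_bigr => i _; rewrite scale1r.
  exact: tensmx11.
(* What remains of [tens1_ptr] after removing the terms with equal indices is a sum of conjugates of
   [X]. *)
have pS : psd (1%:M *t ptr X - S).
  rewrite tens1_ptr /S -sumrB; apply: psd_sum => i _.
  rewrite (bigD1 i) //= -/(E i i) adjE addrAC subrr add0r.
  by apply: psd_sum => j _; apply: psd_conj.
have pinch : psd (a%:R *: S - X).
  have -> : a%:R *: S - X =
      2^-1 *: \sum_i \sum_j (E i i - E j j) *m X *m (E i i - E j j)^t*.
    have -> : \sum_i \sum_j (E i i - E j j) *m X *m (E i i - E j j)^t* =
        2 *: (a%:R *: S - X).
      transitivity (\sum_(i < a) \sum_(j < a)
          (E i i *m X *m E i i + E j j *m X *m E j j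
           - E i i *m X *m E j j - E j j *m X *m E i i)).
        apply: eq_bigr => i _; apply: eq_bigr => j _.
        have -> : (E i i - E j j)^t* = E i i - E j j.
          by rewrite -[in RHS]adjE -[in RHS](adjE j) raddfB /= raddfB.
        rewrite mulmxBl mulmxBr !mulmxBl opprB addrACA.
        by rewrite -[RHS]addrA; congr (_ + _); rewrite addrC.
      transitivity (\sum_(i < a)
          (E i i *m X *m E i i *+ a + S - E i i *m X - X *m E i i)).
        apply: eq_bigr => i _; rewrite !sumrB big_split /= sumr_const card_ord.
        by rewrite -mulmx_sumr sumE mulmx1 -!mulmx_suml sumE mul1mx.
      rewrite !sumrB big_split /= sumr_const card_ord sumrMnl -/S.
      rewrite -mulmx_suml sumE mul1mx -mulmx_sumr sumE mulmx1.
      by rewrite !scaler_nat mulr2n addrACA addrA.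
    by rewrite (scalerA (2^-1) 2) mulVf ?scale1r // pnatr_eq0.
  apply: psdZ; first by rewrite invr_ge0 ler0n.
  by apply: psd_sum => i _; apply: psd_sum => j _; apply: psd_conj.
have -> : a%:R *: (1%:M *t ptr X) - X =
    a%:R *: (1%:M *t ptr X - S) + (a%:R *: S - X).
  by rewrite scalerBr addrA subrK.
by apply: psdD pinch; apply: psdZ => //; rewrite ler0n.
Qed.

End Tensor.

(** * The channel preparing a state that satisfies the reduction criterion *)

Section PrepareChannel.
Variable C : numClosedFieldType.

Lemma mxtrace_delta n (i : 'I_n) : \tr (delta_mx i i : 'M[C]_n) = 1.
Proof.
rewrite /mxtrace (bigD1 i) //= mxE !eqxx big1 ?addr0 // => j /negPf ji.
by rewrite mxE ji.
Qed.

Lemma psd_delta n (i : 'I_n) : psd (delta_mx i i : 'M[C]_n).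
Proof.
have -> : delta_mx i i = delta_mx i (0 : 'I_1) *m (delta_mx i 0)^t* :> 'M[C]_n.
  by rewrite adjmx_delta mul_delta_mx.
exact: psd_gram.
Qed.

Lemma mxtrace_tens m n (A : 'M[C]_m) (B : 'M[C]_n) : \tr (A *t B) = \tr A * \tr B.
Proof. by rewrite -mxtrace_ptr ptr_tens mxtraceZ. Qed.

Lemma mxtrace_tmap a a' b (f : 'M[C]_a -> 'M[C]_a') (X : 'M[C]_(a * b)) :
  (forall Y, \tr (f Y) = \tr Y) -> \tr (tmap f id X) = \tr X.
Proof.
move=> trf; rewrite [in RHS](mxtens_expand X) /tmap.
do 4![rewrite !raddf_sum; apply: eq_bigr => ? _].
by rewrite /= !mxtraceZ !mxtrace_tens trf.
Qed.

Lemma ptr1dim b (X : 'M[C]_(1 * b)) : 1%:M *t ptr X = X.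
Proof.
apply: mxtens_matrixP => i j k l; rewrite tensmxE !mxE big_ord1.
by rewrite !ord1 eqxx mul1r.
Qed.

Variables (a b d : nat) (i0 : 'I_d) (rho : 'M[C]_(a * b)).
Hypothesis da : d = a.

(** Its positivity is the reduction criterion for [rho]. *)
Definition gap := 1%:M *t ptr rho - rho.

(** The input dimension [d] is separate from [a] because it is instantiated by [a * 1], equal to [a]
    only through [muln1]. For [d = 1] the inverse takes its default value 0. *)
Definition prepare_gap (X : 'M[C]_d) : 'M[C]_(a * b) :=
  \tr (delta_mx i0 i0 *m X) *: rho
  + \tr ((1%:M - delta_mx i0 i0) *m X) *: ((d%:R - 1)^-1 *: gap).

Lemma prepare_gap_linear : linear prepare_gap.
Proof.
move=> c X Y; rewrite /prepare_gap !mulmxDr -!scalemxAr !mxtraceD !mxtraceZ.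
by rewrite !scalerDl !scalerDr !scalerA addrACA.
Qed.

Lemma ptr_gap : ptr gap = (d%:R - 1) *: ptr rho.
Proof.
have ptrB (X Y : 'M[C]_(a * b)) : ptr (X - Y) = ptr X - ptr Y.
  by rewrite addrC -[- Y]scaleN1r ptr_linear scaleN1r addrC.
by rewrite ptrB ptr_tens mxtrace1 scalerBl scale1r da.
Qed.

(** Cancelling [d%:R - 1] is legitimate even when it is 0: then [i0] is the only index and the
    complementary effect vanishes. *)
Lemma mxtrace_rest (X : 'M[C]_d) :
  \tr ((1%:M - delta_mx i0 i0) *m X) * ((d%:R - 1)^-1 * (d%:R - 1))
  = \tr ((1%:M - delta_mx i0 i0) *m X).
Proof.
have [/eqP d1|d1] := eqVneq (d%:R - 1 : C) 0; last by rewrite mulVf ?mulr1.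
have -> : 1%:M - delta_mx i0 i0 = 0 :> 'M[C]_d.
  move: d1; rewrite subr_eq0 pnatr_eq1 => /eqP d1; clear da; subst d.
  by apply/matrixP => i j; rewrite !mxE !ord1 eqxx subrr.
by rewrite mul0mx mxtrace0 mul0r.
Qed.

Lemma mxtrace_split (X : 'M[C]_d) :
  \tr (delta_mx i0 i0 *m X) + \tr ((1%:M - delta_mx i0 i0) *m X) = \tr X.
Proof. by rewrite -mxtraceD -mulmxDl addrC subrK mul1mx. Qed.

(** Both branches have marginals proportional to that of [rho], so the measurement outcome is
    invisible on B. This yields semi-causality as well as trace preservation. *)
Lemma ptr_prepare_gap X : ptr (prepare_gap X) = \tr X *: ptr rho.
Proof.
rewrite /prepare_gap ptr_linear (linear_scaleP (@ptr_linear _ _ _)).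
rewrite (linear_scaleP (@ptr_linear _ _ _)) ptr_gap.
by rewrite !scalerA -mulrA mxtrace_rest -scalerDl mxtrace_split.
Qed.

(** On the identity the two outcomes have weights 1 and [d%:R - 1], so [rho] and [gap] add up; this
    is the source of conditional unitality. *)
Lemma prepare_gap1 : prepare_gap 1%:M = 1%:M *t ptr rho.
Proof.
rewrite /prepare_gap !mulmx1 linearB /= mxtrace1 mxtrace_delta scale1r scalerA.
have [/eqP d1|d1] := eqVneq (d%:R - 1 : C) 0; last first.
  by rewrite mulfV // scale1r addrC subrK.
have gap0 : gap = 0.
  move: d1; rewrite subr_eq0 pnatr_eq1 => /eqP d1.
  move: (da); rewrite d1 /gap => a1; case: _ / a1 rho => X.
  by rewrite ptr1dim subrr.
rewrite gap0 scaler0 addr0; move: gap0 => /eqP.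
by rewrite /gap subr_eq0 => /eqP ->.
Qed.

Lemma cp_prepare_gap : psd rho -> psd gap -> cp prepare_gap.
Proof.
move=> prho pgap.
pose E (t : bool) : 'M[C]_d :=
  if t then delta_mx i0 i0 else 1%:M - delta_mx i0 i0.
have pE1 : psd (1%:M - delta_mx i0 i0 : 'M[C]_d).
  rewrite scalar_mx_sum_delta (bigD1 i0) //= scale1r addrC addrK.
  apply: psd_sum => i _; rewrite scale1r; exact: psd_delta.
apply: (@eq_cp _ _ _ (fun X => \sum_(t : bool) \tr (E t *m X)
          *: (if t then rho else (d%:R - 1)^-1 *: gap))).
  by move=> X; rewrite big_bool.
apply: cp_sum => -[]; apply: cp_measure_prepare => //; first exact: psd_delta.
apply: psdZ => //; rewrite invr_ge0 subr_ge0 ler1n.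
exact: leq_ltn_trans (ltn_ord i0).
Qed.

Lemma prepare_gap_delta : prepare_gap (delta_mx i0 i0) = rho.
Proof.
rewrite /prepare_gap mulmxBl mul1mx mul_delta_mx subrr mxtrace0 scale0r addr0.
by rewrite mxtrace_delta scale1r.
Qed.

End PrepareChannel.

(** * The prepared channel on inputs with a one-dimensional B *)

Section PrepareChannelTrivial.
Variables (C : numClosedFieldType) (a b : nat) (i0 : 'I_a) (rho : 'M[C]_(a * b)).

(** On a one-dimensional system trace 1 forces [r] to be 1, so the input is a multiple of the
    identity. *)
Lemma prepare_gap_uniform c (r : 'M[C]_1) : \tr r = 1 ->
  prepare_gap (mxtens_index (i0, ord0)) rho (c%:M *t r) = c%:M *t ptr rho.
Proof.
rewrite [r]mx11_scalar mxtrace_scalar mulr1n => ->.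
have -> : c%:M *t 1%:M = c *: 1%:M :> 'M[C]_(a * 1).
  by rewrite -(tensmx11 _ a 1) -(linear_scaleP (@tensmx_linearl _ _ _ _ _ _)) scalemx1.
rewrite (linear_scaleP (@prepare_gap_linear _ _ _ _ _ _)) (prepare_gap1 _ _ (muln1 a)).
by rewrite -(linear_scaleP (@tensmx_linearl _ _ _ _ _ _)) scalemx1.
Qed.

(** [K] embeds the trivial system as the basis vector [i0]; the right side is [rho] under the
    identity isometry, in the shape that majorization asks for. *)
Lemma prepare_gap_pure (K := delta_mx i0 0 *t 1%:M : 'M[C]_(a * 1, 1 * 1)) :
  prepare_gap (mxtens_index (i0, ord0)) rho (K *m 1%:M *m K^t*)
  = (1%:M *t 1%:M) *m rho *m (1%:M *t 1%:M)^t*.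
Proof.
rewrite (tensmx11 _ a b) (adjmx1 _ (a * b)) mul1mx mulmx1.
rewrite mulmx1 /K adjmx_tens adjmx_delta tensmx_mul mul_delta_mx adjmx1 mul1mx.
have -> : (1%:M : 'M[C]_1) = delta_mx ord0 ord0.
  by apply/matrixP => i j; rewrite !ord1 !mxE.
by rewrite -delta_mx_tens prepare_gap_delta.
Qed.

End PrepareChannelTrivial.

(** * Loewner order relative to the reduced state *)

Section ReducedOrder.
Variable C : numClosedFieldType.

Lemma sesqui_diff n (c : C) (X Y : 'M[C]_n) (v : 'cV[C]_n) :
  (v^t* *m (c *: Y - X) *m v) 0 0
  = c * (v^t* *m Y *m v) 0 0 - (v^t* *m X *m v) 0 0.
Proof.
rewrite mulmxBr mulmxBl -scalemxAr -scalemxAl.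
by move: (_ *m v) (_ *m v) => A B; rewrite !mxE.
Qed.

Lemma linear_diff (U V : lmodType C) (f : U -> V) : linear f ->
  forall c u v, f (c *: u - v) = c *: f u - f v.
Proof.
move=> lf c u v.
by rewrite lf -(scaleN1r v) (linear_scaleP lf) scaleN1r.
Qed.

(** The complement of the range projection is itself an orthogonal projection, hence its own Gram
    matrix. *)
Lemma psd_isometry_compl m n (U : 'M[C]_(m, n)) :
  U^t* *m U = 1%:M -> psd (1%:M - U *m U^t*).
Proof.
move=> UU; have -> : 1%:M - U *m U^t* = (1%:M - U *m U^t*) *m (1%:M - U *m U^t*)^t*.
  have -> : (1%:M - U *m U^t*)^t* = 1%:M - U *m U^t*.
    by rewrite raddfB /= raddfB /= adjmx1 adjmxM trmxCK.
  rewrite mulmxBl mul1mx mulmxBr mulmx1 -mulmxA [U^t* *m (U *m _)]mulmxA UU.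
  by rewrite mul1mx subrr subr0.
exact: psd_gram.
Qed.

(** Conjugating the hypothesis only covers the range of [V]; on the orthogonal complement the
    missing term is [c] times a projection tensored with [Y]. *)
Lemma isometry_push a a' b (V : 'M[C]_(a', a)) (X : 'M[C]_(a * b)) (Y : 'M[C]_b) c :
  V^t* *m V = 1%:M -> 0 <= c -> psd Y -> psd (c *: (1%:M *t Y) - X) ->
  psd (c *: (1%:M *t Y) - (V *t 1%:M) *m X *m (V *t 1%:M)^t*).
Proof.
move=> VV c0 pY pX; set W := V *t 1%:M.
have -> : c *: (1%:M *t Y) - W *m X *m W^t* =
    W *m (c *: (1%:M *t Y) - X) *m W^t* + c *: ((1%:M - V *m V^t*) *t Y).
  have -> : (1%:M - V *m V^t*) *t Y = 1%:M *t Y - (V *m V^t*) *t Y.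
    by apply/matrixP => x y; rewrite !mxE mulrBl.
  rewrite (linear_diff (@sandwich_linear _ _ _ _ _ W (W^t*))).
  rewrite {2}/W adjmx_tens adjmx1 !tensmx_mul mulmx1 mul1mx mulmx1.
  by rewrite scalerBr [RHS]addrC addrA subrK.
apply: psdD; first exact: psd_conj.
by apply: psdZ => //; apply: psd_tens => //; apply: psd_isometry_compl.
Qed.

Lemma isometry_pull a a' b (U : 'M[C]_(a', a)) (X : 'M[C]_(a * b)) (Y : 'M[C]_b) c :
  U^t* *m U = 1%:M ->
  psd (c *: (1%:M *t Y) - (U *t 1%:M) *m X *m (U *t 1%:M)^t*) ->
  psd (c *: (1%:M *t Y) - X).
Proof.
move=> UU /(psd_conj ((U *t 1%:M)^t*)).
rewrite (linear_diff (@sandwich_linear _ _ _ _ _ _ _)) trmxCK !mulmxA.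
set W := U *t 1%:M.
have WW : W^t* *m W = 1%:M.
  by rewrite /W adjmx_tens adjmx1 tensmx_mul UU mulmx1 tensmx11.
rewrite WW mul1mx -(mulmxA X) WW mulmx1 {1}/W adjmx_tens adjmx1 /W !tensmx_mul.
by rewrite mulmx1 UU mul1mx mulmx1.
Qed.

(** Complete positivity with a one-dimensional ancilla, which the partial trace then removes. *)
Lemma cp_pos m n (f : 'M[C]_m -> 'M[C]_n) X : linear f -> cp f -> psd X -> psd (f X).
Proof.
move=> lf cf pX.
have := cf 1 (1%:M *t X) (psd_tens (@psd1 _ 1) pX).
rewrite tmap_tens // => /psd_ptr.
by rewrite ptr_tens mxtrace1 scale1r.
Qed.

Lemma linear_uniform a b b' (f : 'M[C]_(a * b) -> 'M[C]_(a * b')) X Y :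
  (0 < a)%N -> linear f ->
  f ((a%:R^-1)%:M *t X) = (a%:R^-1)%:M *t Y -> f (1%:M *t X) = 1%:M *t Y.
Proof.
move=> a0 lf fXY.
have E n (Z : 'M[C]_n) : (1%:M : 'M[C]_a) *t Z = a%:R *: ((a%:R^-1)%:M *t Z).
  rewrite -(linear_scaleP (@tensmx_linearl _ _ _ _ _ _)) scale_scalar_mx.
  by rewrite mulfV // pnatr_eq0 -lt0n.
by rewrite !E (linear_scaleP lf) fXY.
Qed.

Lemma ptr_uniform a b (X : 'M[C]_b) :
  (0 < a)%N -> ptr ((a%:R^-1)%:M *t X : 'M_(a * b)) = X.
Proof.
move=> a0; rewrite ptr_tens mxtrace_scalar -[_^-1 *+ _]mulr_natr mulVf ?scale1r //.
by rewrite pnatr_eq0 -lt0n.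
Qed.

(** The difference telescopes into two products of positive semidefinite factors. It shows that
    constants for the factors multiply to a constant for the product. *)
Lemma psd_tens_diff m n (X Y : 'M[C]_m) (Z T : 'M[C]_n) c d :
  psd X -> psd T -> 0 <= d -> psd (c *: Y - X) -> psd (d *: T - Z) ->
  psd ((c * d) *: (Y *t T) - X *t Z).
Proof.
move=> pX pT d0 cYX dTZ.
have -> : (c * d) *: (Y *t T) - X *t Z = (c *: Y - X) *t (d *: T) + X *t (d *: T - Z).
  by apply/matrixP => x y; rewrite !mxE; ring.
by apply: psdD; apply: psd_tens => //; apply: psdZ.
Qed.

Lemma tens1_ptr_reorder a b a' b' (X : 'M[C]_(a * b)) (Y : 'M[C]_(a' * b')) :
  1%:M *t ptr (reorder (X *t Y))
  = reorder (((1%:M : 'M_a) *t ptr X) *t ((1%:M : 'M_a') *t ptr Y)).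
Proof. by rewrite ptr_reorder reorder_tens tensmx11. Qed.

Lemma reorder_linear a b a' b' : linear (@reorder C a b a' b').
Proof. by move=> c X Y; apply/matrixP => i j; rewrite !mxE. Qed.

Lemma psd_diff_reorder a b a' b' (X Y : 'M[C]_((a * b) * (a' * b'))) c :
  psd (c *: reorder Y - reorder X) <-> psd (c *: Y - X).
Proof.
by rewrite -(linear_diff (@reorder_linear _ _ _ _)); apply: psd_reorder.
Qed.

Lemma mxtrace_reorder a b a' b' (X : 'M[C]_(a * b)) (Y : 'M[C]_(a' * b')) :
  \tr (reorder (X *t Y)) = \tr X * \tr Y.
Proof. by rewrite -mxtrace_ptr ptr_reorder mxtrace_tens !mxtrace_ptr. Qed.

Lemma mxtrace_neq0 n (X : 'M[C]_n) : \tr X != 0 ->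
  exists v : 'cV[C]_n, (v^t* *m X *m v) 0 0 != 0.
Proof.
have [i Xii _|X0] := pickP (fun i => X i i != 0).
  by exists (delta_mx i 0); rewrite sesqui_delta.
by rewrite /mxtrace big1 ?eqxx // => i _; apply/eqP; rewrite -[_ == _]negbK X0.
Qed.

Lemma psd_scalar n (c : C) : 0 <= c -> psd (c%:M : 'M[C]_n).
Proof. by move=> c0; rewrite -scalemx1; apply: psdZ => //; apply: psd1. Qed.

Lemma psd_reduced_uniform2 (rho := (2^-1)%:M *t 1%:M : 'M[C]_(2 * 1)) :
  psd (2^-1 *: (1%:M *t ptr rho) - rho).
Proof.
rewrite /rho ptr_tens mxtrace_scalar -[_^-1 *+ _]mulr_natr mulVf ?pnatr_eq0 //.
rewrite scale1r.
rewrite -(linear_scaleP (@tensmx_linearl _ _ _ _ _ _)) scalemx1 subrr.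
exact: psd0.
Qed.

End ReducedOrder.

(** * The trivial state majorizes under the reduction criterion *)

Section TrivialState.
Variable R : realType.
Local Notation C := R[i].

Lemma tensor_mapE a a' b b' (f : 'M[C]_a -> 'M[C]_a') (g : 'M[C]_b -> 'M[C]_b') X :
  tensor_map f g X = tmap f g X.
Proof. by []. Qed.

Lemma bipartite_tensorE a b a' b' (X : 'M[C]_(a * b)) (Y : 'M[C]_(a' * b')) :
  bipartite_tensor X Y = reorder (X *t Y).
Proof. by []. Qed.

Lemma density_dim_gt0 a b (rho : 'M[C]_(a * b)) : density rho -> (0 < a)%N.
Proof.
case: a rho => // rho [_ /esym/eqP].
by rewrite /mxtrace big_ord0 oner_eq0.
Qed.

(** Channels are bundled maps; the existential hides the bundle and exposes only its values. *)
Lemma bundle_linear m n (f : 'M[C]_m -> 'M[C]_n) :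
  linear f -> exists F : {linear 'M[C]_m -> 'M[C]_n}, forall X, F X = f X.
Proof.
move=> lf.
by exists (HB.pack_for {linear 'M[C]_m -> 'M[C]_n} f
          (GRing.isLinear.Build C _ _ *:%R f lf)).
Qed.

Lemma prepare_gap_channel a b d (i0 : 'I_d) (rho : 'M[C]_(a * b)) :
  d = a -> density rho -> loewner_le rho (1%:M *t ptrace1 rho) ->
  exists F : {linear 'M[C]_d -> 'M[C]_(a * b)},
    channel F /\ forall X, F X = prepare_gap i0 rho X.
Proof.
move=> da [prho trrho] red.
have [F FE] := bundle_linear (@prepare_gap_linear _ _ _ _ i0 rho).
exists F; split=> //; split.
  apply: (@eq_cp _ _ _ (prepare_gap i0 rho)) => [X|]; first by rewrite FE.
  exact: (@cp_prepare_gap C a b d i0 rho prho red).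
by move=> X; rewrite FE -mxtrace_ptr ptr_prepare_gap // mxtraceZ mxtrace_ptr trrho mulr1.
Qed.

Lemma bundle_conj m n (K : 'M[C]_(n, m)) :
  exists F : {linear 'M[C]_m -> 'M[C]_n}, forall X, F X = K *m X *m K^t*.
Proof. exact: bundle_linear (@sandwich_linear _ _ _ _ _ K (K^t*)). Qed.

Lemma tensor_map_idr a a' b (f : 'M[C]_a -> 'M[C]_a') (K : 'M[C]_(a', a))
    (X : 'M[C]_(a * b)) :
  (forall Y, f Y = K *m Y *m K^t*) ->
  tensor_map f (@id 'M_b) X = (K *t 1%:M) *m X *m (K *t 1%:M)^t*.
Proof.
move=> fK; rewrite tensor_mapE (eq_tmap fK (@id_conj _ _)).
exact: tmap_conj.
Qed.

Lemma trivial_majorizes a b (rho : 'M[C]_(a * b)) :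
  density rho -> loewner_le rho (1%:M *t ptrace1 rho) ->
  cond_majorizes (1%:M : 'M[C]_(1 * 1)) rho.
Proof.
move=> drho red; have [prho trrho] := drho.
have a0 := density_dim_gt0 drho.
pose i0 : 'I_a := Ordinal a0.
have [N [chN NE]] := prepare_gap_channel (mxtens_index (i0, ord0)) (muln1 a) drho red.
(* Take [c = a]: [V] embeds the trivial system as the basis vector [i0], and [U] is the identity. *)
have [V VE] := bundle_conj (delta_mx i0 ord0 : 'M[C]_(a, 1)).
have [U UE] := bundle_conj (1%:M : 'M[C]_a).
exists a, V, U, N; split.
- by rewrite geq_max a0 leqnn.
- exists (delta_mx i0 ord0); split=> //.
  by rewrite adjmx_delta mul_delta_mx; apply/matrixP => i j; rewrite !ord1 !mxE.
- by exists 1%:M; split=> //; rewrite adjmx1 mulmx1.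
- split=> //.
    move=> r [_ trr]; exists (ptrace1 rho); split.
      by split; [exact: psd_ptr|rewrite -trrho; exact: mxtrace_ptr].
    by rewrite NE; apply: prepare_gap_uniform.
  (* Both marginals are the trace of the input times that of [rho], and [M] preserves the trace. *)
  move=> M [_ trM] X; rewrite !NE.
  rewrite [LHS](ptr_prepare_gap _ _ (muln1 a)) [RHS](ptr_prepare_gap _ _ (muln1 a)).
  by congr (_ *: _); apply: mxtrace_tmap.
rewrite (tensor_map_idr _ UE) (tensor_map_idr _ VE) NE.
exact/esym/prepare_gap_pure.
Qed.

(** The trivial state is its own tensor square, so additivity says that its entropy equals twice
    itself. *)
Lemma entropy_trivial (H : forall a b : nat, 'M[C]_(a * b) -> R) :
  quantum_cond_entropy H -> H 1 1 (1%:M : 'M[C]_(1 * 1)) = 0.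
Proof.
case=> _ _ add.
have d1 : density (1%:M : 'M[C]_(1 * 1)).
  by split; [exact: psd1|rewrite mxtrace1].
have := add _ _ _ _ _ _ d1 d1.
have -> : bipartite_tensor (1%:M : 'M[C]_(1 * 1)) (1%:M : 'M[C]_(1 * 1)) = 1%:M.
  exact: (@reorder11 C 1 1 1 1).
move/eqP; rewrite -[X in X == _]addr0 => /eqP/addrI/esym.
exact.
Qed.

End TrivialState.

(** * The conditional min-entropy *)

Section DominationConstant.
Variable R : realType.

(** For quadratic forms [p] of X and [w] of Y these are the constants with X below [l] times Y; the
    order analysis then concerns real functions only. *)
Definition dominators T (p w : T -> R) : set R :=
  [set l | forall v, p v <= l * w v]%classic.

(** A point with [p] positive forces every dominating constant to be positive; with nonemptiness the
    infimum is a genuine positive real, fit for [ln]. *)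
Definition admissible T (p w : T -> R) : Prop :=
  [/\ forall v, 0 <= p v, forall v, 0 <= w v, exists v, 0 < p v &
      (dominators p w !=set0)%classic].

Lemma dominator_pos T (p w : T -> R) l : admissible p w -> dominators p w l -> 0 < l.
Proof.
case=> p0 w0 [v pv] _ /(_ v) /(lt_le_trans pv) lw.
have [wv|wv] := eqVneq (w v) 0; first by rewrite wv mulr0 ltxx in lw.
by rewrite -(pmulr_lgt0 _ (_ : 0 < w v)) // lt_neqAle eq_sym wv w0.
Qed.

Lemma has_lbound_dominators T (p w : T -> R) :
  admissible p w -> has_lbound (dominators p w).
Proof. by move=> adm; exists 0 => l /(dominator_pos adm)/ltW. Qed.

(** The infimum is attained: at each [v] the constraint either does not involve [l], or bounds it
    below by [p v / w v]. *)
Lemma dominators_inf T (p w : T -> R) :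
  admissible p w -> dominators p w (inf (dominators p w)).
Proof.
move=> adm v; have [p0 w0 _ ne] := adm.
have [wv|wv] := eqVneq (w v) 0.
  by have [l /(_ v)] := ne; rewrite wv !mulr0.
have {wv} : 0 < w v by rewrite lt_neqAle eq_sym wv w0.
move=> wv; rewrite -ler_pdivrMr //; apply: lb_le_inf => // l /(_ v).
by rewrite ler_pdivrMr.
Qed.

Lemma inf_dominators_gt0 T (p w : T -> R) : admissible p w -> 0 < inf (dominators p w).
Proof. by move=> adm; apply: (dominator_pos adm); apply: dominators_inf. Qed.

Lemma inf_dominators_le T (p w : T -> R) l : admissible p w ->
  inf (dominators p w) <= l <-> dominators p w l.
Proof.
move=> adm; split=> [infl v|]; last by apply: ge_inf; apply: has_lbound_dominators.
by apply: le_trans (dominators_inf adm v) _; case: adm => _ w0 _ _; apply: ler_wpM2r.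
Qed.

(** [up] applied to the optimal constants gives one inequality. For the other, [down] is optimized
    over [v] with [v'] fixed, and then over [v']. *)
Lemma inf_dominatorsM T T' T'' (p w : T -> R) (p' w' : T' -> R) (p'' w'' : T'' -> R) :
  admissible p w -> admissible p' w' -> admissible p'' w'' ->
  (forall l l', dominators p w l -> dominators p' w' l' -> dominators p'' w'' (l * l')) ->
  (forall l, dominators p'' w'' l -> forall v v', p v * p' v' <= l * (w v * w' v')) ->
  inf (dominators p'' w'') = inf (dominators p w) * inf (dominators p' w').
Proof.
move=> adm adm' adm'' up down; set m := inf (dominators p w).
have m0 : 0 < m by apply: inf_dominators_gt0.
apply/le_anti/andP; split.
  by apply/inf_dominators_le => //; apply: up; apply: dominators_inf.
rewrite mulrC -ler_pdivlMr //; apply/inf_dominators_le => // v'.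
set n := inf (dominators p'' w'').
have n0 : 0 < n by apply: inf_dominators_gt0.
have [p0' w0' _ _] := adm'.
have [p'0|p'0] := eqVneq (p' v') 0.
  by rewrite p'0 mulr_ge0 // divr_ge0 // ltW.
have p'v : 0 < p' v' by rewrite lt_neqAle eq_sym p'0 p0'.
(* For this fixed [v'], the right side is a constant dominating [p] by [w]. *)
suff : m <= n * w' v' / p' v'.
  by rewrite ler_pdivlMr // mulrAC ler_pdivlMr // [m * _]mulrC.
apply/inf_dominators_le => // v.
have := down _ (dominators_inf adm'') v v'; rewrite -/n => h.
rewrite mulrAC ler_pdivlMr //.
by have -> : n * w' v' * w v = n * (w v * w' v') by ring.
Qed.

End DominationConstant.

(** * The min-entropy satisfies the axioms of a conditional entropy *)

Section MinEntropy.
Variable R : realType.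
Local Notation C := R[i].
Local Notation "l %:C" := (real_complex R l).

(** The real part makes the infimum one over reals; by [qformE] it loses nothing on positive
    semidefinite matrices. *)
Definition qform n (X : 'M[C]_n) (v : 'cV[C]_n) : R :=
  complex.Re ((v^t* *m X *m v) 0 0).

Lemma qformE n (X : 'M[C]_n) v : psdmx X -> (v^t* *m X *m v) 0 0 = (qform X v)%:C.
Proof. by move=> pX; rewrite RRe_real // ger0_real. Qed.

Lemma qform_ge0 n (X : 'M[C]_n) v : psdmx X -> 0 <= qform X v.
Proof. by move=> pX; rewrite -ler0c -qformE. Qed.

Lemma loewner_dominators n (X Y : 'M[C]_n) l : psdmx X -> psdmx Y ->
  loewner_le X (l%:C *: Y) <-> dominators (qform X) (qform Y) l.
Proof.
move=> pX pY; split=> h v; have E := @sesqui_diff C n (l%:C) X Y v.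
  have := h v; rewrite E !qformE // -rmorphM -rmorphB ler0c subr_ge0.
  exact.
rewrite E !qformE // -rmorphM -rmorphB ler0c subr_ge0.
exact: h.
Qed.

Definition reduced a b (rho : 'M[C]_(a * b)) : 'M[C]_(a * b) := 1%:M *t ptrace1 rho.

Lemma psdmx_reduced a b (rho : 'M[C]_(a * b)) : psdmx rho -> psdmx (reduced rho).
Proof. by move=> prho; exact: psd_tens (@psd1 C a) (psd_ptr prho). Qed.

Lemma admissible_density a b (rho : 'M[C]_(a * b)) : density rho ->
  admissible (qform rho) (qform (reduced rho)).
Proof.
move=> [prho trrho]; split=> [v|v||].
- exact: qform_ge0.
- exact/qform_ge0/psdmx_reduced.
- have [v] : exists v : 'cV[C]_(a * b), (v^t* *m rho *m v) 0 0 != 0.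
    by apply: mxtrace_neq0; rewrite trrho oner_eq0.
  rewrite qformE // => qv; exists v.
  by rewrite lt_neqAle qform_ge0 // eq_sym andbT; apply: contraNneq qv => ->.
(* The pinching inequality supplies the dimension of A as a dominating constant. *)
exists a%:R; apply/(loewner_dominators _ prho (psdmx_reduced prho)).
rewrite rmorph_nat; exact: psd_pinching.
Qed.

(** The version of the conditional min-entropy whose reference on B is the marginal itself, with no
    optimization over states of B. *)
Definition min_entropy a b (rho : 'M[C]_(a * b)) : R :=
  - ln (inf (dominators (qform rho) (qform (reduced rho)))).

(** Nonnegativity means that the infimum is at most 1; since it is attained, this says that the
    constant 1 dominates. *)
Lemma min_entropy_ge0 a b (rho : 'M[C]_(a * b)) : density rho ->
  0 <= min_entropy rho <-> loewner_le rho (reduced rho).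
Proof.
move=> drho; have adm := admissible_density drho; have [prho _] := drho.
rewrite -[X in loewner_le _ X]scale1r.
rewrite -[1 in X in loewner_le _ X](rmorph1 (real_complex R)).
rewrite (loewner_dominators _ prho (psdmx_reduced prho)).
rewrite -inf_dominators_le // /min_entropy oppr_ge0 -[0]ln1.
by rewrite ler_ln // posrE ?inf_dominators_gt0.
Qed.

Lemma loewner_reduced_inf a b (rho : 'M[C]_(a * b)) l : density rho ->
  loewner_le rho (l%:C *: reduced rho) <->
  inf (dominators (qform rho) (qform (reduced rho))) <= l.
Proof.
move=> drho; have adm := admissible_density drho; have [prho _] := drho.
rewrite (inf_dominators_le _ adm).
exact: (loewner_dominators l prho (psdmx_reduced prho)).
Qed.

Lemma min_entropy_le a b a' b' (rho : 'M[C]_(a * b)) (sigma : 'M[C]_(a' * b')) :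
  density rho -> density sigma ->
  (forall l, 0 <= l -> loewner_le rho (l%:C *: reduced rho) ->
             loewner_le sigma (l%:C *: reduced sigma)) ->
  min_entropy rho <= min_entropy sigma.
Proof.
move=> drho dsigma imp.
have adm := admissible_density drho; have adm' := admissible_density dsigma.
rewrite lerN2 ler_ln ?posrE ?inf_dominators_gt0 //.
apply/(loewner_reduced_inf _ dsigma)/imp; first exact/ltW/inf_dominators_gt0.
exact/loewner_reduced_inf.
Qed.

Lemma depolarizing a : (0 < a)%N ->
  exists M : {linear 'M[C]_a -> 'M[C]_a},
    channel M /\ forall X, M X = \tr X *: uniform_state R a.
Proof.
move=> a0.
have lf : linear (fun X : 'M[C]_a => \tr X *: uniform_state R a).
  by move=> c X Y; rewrite mxtraceD mxtraceZ scalerDl scalerA.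
have [M ME] := bundle_linear lf; exists M; split=> //; split.
  (* With the identity as effect this is a measure-and-prepare map. *)
  apply: (@eq_cp _ _ _ (fun X : 'M[C]_a => \tr (1%:M *m X) *: uniform_state R a)).
    by move=> X; rewrite mul1mx ME.
  apply: cp_measure_prepare; first exact: psd1.
  by apply: psd_scalar; rewrite invr_ge0 ler0n.
move=> X; rewrite ME mxtraceZ mxtrace_scalar -[_^-1 *+ _]mulr_natr mulVf ?mulr1 //.
by rewrite pnatr_eq0 -lt0n.
Qed.

(** Depolarizing A replaces [X] by the uniform state times [X_B]. Unitality gives the image a
    product form with some [tau], and semi-causality identifies [tau] as the marginal of [N X]. *)
Lemma conditionally_mixing_marginal a b b' (N : {linear 'M[C]_(a * b) -> 'M[C]_(a * b')})
    (X : 'M[C]_(a * b)) : conditionally_mixing N -> density X ->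
  N (reduced X) = reduced (N X).
Proof.
move=> [_ unitalN semiN] dX; have a0 := density_dim_gt0 dX.
have [pX trX] := dX.
have [|tau [_ Ntau]] := unitalN (ptrace1 X).
  by split; [exact: psd_ptr|rewrite -trX; exact: mxtrace_ptr].
have [M [chM ME]] := depolarizing a0.
have := semiN M chM X.
have -> : tensor_map M id X = uniform_state R a *t ptrace1 X.
  rewrite tensor_mapE (eq_tmap ME (frefl _)); exact: tmap_prepare.
rewrite Ntau => mN.
have tauE : tau = ptrace1 (N X) by rewrite -mN; apply/esym/ptr_uniform.
rewrite /reduced -tauE.
exact: (linear_uniform a0 (linearP N) Ntau).
Qed.

(** The inequality for [rho] is pushed along [V], mapped by the positive map [N], and pulled back
    along [U]; each step keeps the same constant. *)
Lemma min_entropy_monotone a b a' b' (rho : 'M[C]_(a * b)) (sigma : 'M[C]_(a' * b')) :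
  density rho -> density sigma -> cond_majorizes rho sigma ->
  min_entropy rho <= min_entropy sigma.
Proof.
move=> drho dsigma [c [V [U [N [_ [KV [KVV VE]] [KU [KUU UE]] mixN]]]]].
rewrite (tensor_map_idr _ UE) (tensor_map_idr _ VE).
set Y := _ *m rho *m _ => sigmaE.
have [prho trrho] := drho.
have redY : ptrace1 Y = ptrace1 rho by apply: ptr_isometry.
have dY : density Y.
  split; first exact: psd_conj.
  by rewrite -trrho -[LHS]mxtrace_ptr -[RHS]mxtrace_ptr; congr (\tr _).
have NY := conditionally_mixing_marginal mixN dY.
have redNY : ptrace1 (N Y) = ptrace1 sigma by rewrite -sigmaE; apply: ptr_isometry.
apply: min_entropy_le => // l l0 rhol.
apply: (isometry_pull KUU).
have pY : psd (l%:C *: reduced Y - Y).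
  rewrite /reduced redY; apply: isometry_push => //; first by rewrite ler0c.
  exact: (psd_ptr prho).
have [[cpN _] _ _] := mixN.
have := cp_pos (linearP N) cpN pY.
rewrite (linear_diff (linearP N)) NY /reduced redNY -sigmaE.
exact.
Qed.

Lemma density_bipartite a b a' b' (rho : 'M[C]_(a * b)) (sigma : 'M[C]_(a' * b')) :
  density rho -> density sigma -> density (bipartite_tensor rho sigma).
Proof.
move=> [prho trrho] [psigma trsigma]; split.
  by apply/psd_reorder; apply: psd_tens.
by rewrite bipartite_tensorE mxtrace_reorder trrho trsigma mulr1.
Qed.

Lemma min_entropy_additive a b a' b' (rho : 'M[C]_(a * b)) (sigma : 'M[C]_(a' * b')) :
  density rho -> density sigma ->
  min_entropy (bipartite_tensor rho sigma) = min_entropy rho + min_entropy sigma.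
Proof.
move=> drho dsigma; have dbip := density_bipartite drho dsigma.
have adm := admissible_density drho; have adm' := admissible_density dsigma.
have [prho _] := drho; have [psigma _] := dsigma; have [pbip _] := dbip.
have predrho := psdmx_reduced prho; have predsigma := psdmx_reduced psigma.
have predbip := psdmx_reduced pbip.
have redE : reduced (bipartite_tensor rho sigma)
    = bipartite_tensor (reduced rho) (reduced sigma).
  exact: tens1_ptr_reorder.
rewrite -opprD -lnM ?posrE ?inf_dominators_gt0 //; congr (- ln _).
apply: inf_dominatorsM => // [|l l'|l]; first exact: admissible_density.
  move=> ldom ldom'; have l0' : 0 <= l'%:C by rewrite ler0c ltW // (dominator_pos adm').
  have rhol := (loewner_dominators l prho predrho).2 ldom.
  have sigmal := (loewner_dominators l' psigma predsigma).2 ldom'.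
  apply: (loewner_dominators _ pbip predbip).1; rewrite redE rmorphM.
  apply: (psd_diff_reorder _ _ _).2.
  exact: (psd_tens_diff prho predsigma l0' rhol sigmal).
move=> /(loewner_dominators _ pbip predbip).2; rewrite redE => bipl u v.
(* On a product vector both quadratic forms factor, which is the [down] hypothesis. *)
have := (psd_diff_reorder _ _ _).1 bipl (u *t v : 'cV[C]_((a * b) * (a' * b'))).
rewrite sesqui_diff !sesqui_tens (qformE u prho) (qformE v psigma).
rewrite (qformE u predrho) (qformE v predsigma) -!rmorphM -rmorphB ler0c subr_ge0.
exact.
Qed.

Lemma min_entropy_nontrivial :
  exists (a : nat) (rho : 'M[C]_(a * 1)), density rho /\ min_entropy rho <> 0.
Proof.
(* For the uniform two-dimensional state the constant 1/2 already dominates, so the entropy is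
   nonzero. *)
pose rho : 'M[C]_(2 * 1) := (2^-1)%:M *t 1%:M.
have drho : density rho.
  split; first apply: psd_tens.
  - by apply: psd_scalar; rewrite invr_ge0 ler0n.
  - exact: psd1.
  rewrite mxtrace_tens mxtrace_scalar mxtrace1 mulr1.
  by rewrite -[_^-1 *+ _]mulr_natr mulVf ?pnatr_eq0.
exists 2, rho; split=> //; apply/eqP; rewrite oppr_eq0.
have inf_le : inf (dominators (qform rho) (qform (reduced rho))) <= 2^-1.
  apply/loewner_reduced_inf => //.
  rewrite fmorphV rmorph_nat; exact: psd_reduced_uniform2.
rewrite lt_eqF // ln_lt0 // inf_dominators_gt0 /=; last exact: admissible_density.
by apply: le_lt_trans inf_le _; rewrite invf_lt1 ?ltr1n.
Qed.

Lemma min_entropy_qce : quantum_cond_entropy (fun a b => @min_entropy a b).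
Proof.
split; first exact: min_entropy_nontrivial.
- exact: min_entropy_monotone.
- exact: min_entropy_additive.
Qed.

End MinEntropy.

Theorem corollary1 (R : realType) (a b : nat) (rho : 'M[R[i]]_(a * b))
    (rho_density : density rho) :
  (forall H : (forall a b : nat, 'M[R[i]]_(a * b) -> R),
      quantum_cond_entropy H -> 0 <= H a b rho)
  <-> loewner_le rho ((1%:M : 'M[R[i]]_a) *t ptrace1 rho).
Proof.
split=> [Hge0|red H qH].
  apply/min_entropy_ge0 => //; exact: (Hge0 _ (@min_entropy_qce R)).
(* Reading 0 as the entropy of the trivial state reduces the claim to majorization. *)
rewrite -(entropy_trivial qH); apply: (qce_monotone qH) => //.
  by split; [exact: psd1|rewrite mxtrace1].
exact: trivial_majorizes.
Qed.
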